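(* The graph $\Xi(S_8)$ is connected with diameter $6$.
   Context: A subset $\{x_1,\ldots,x_t\}$ of a finite group $G$ invariably generates $G$ if $\langle x_1^{g_1},\ldots,x_t^{g_t}\rangle=G$ for all $g_1,\ldots,g_t\in G$ (where $x^g$ denotes a conjugate of $x$). The invariably generating graph $\Lambda(G)$ is the undirected graph whose vertices are the conjugacy classes of $G$ different from $\{1\}$, two vertices $x^G$ and $y^G$ being adjacent if and only if $\{x,y\}$ invariably generates $G$. The graph $\Xi(G)$ is obtained from $\Lambda(G)$ by removing the isolated vertices (those adjacent to no vertex). *)

(* Defs.v *)
From mathcomp Require Import all_boot all_fingroup.

Set Implicit Arguments.
Unset Strict Implicit.
Unset Printing Implicit Defensive.

(* Finite simple graphs whose vertices lie in a fixed finite type T. *)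
Record graph (T : finType) := Graph {
  vertices : {set T};
  adj : rel T;
  adj_vertices : forall x y, adj x y -> (x \in vertices) && (y \in vertices);
  adj_sym : symmetric adj;
  adj_irr : irreflexive adj
}.

Section GraphNotions.

Variable T : finType.
Implicit Types (X : graph T) (x y : T).

Definition isolated X x : bool :=
  (x \in vertices X) && [forall y in vertices X, ~~ adj X x y].

Definition induced_adj X (W : {set T}) : rel T :=
  [rel x y | [&& x \in W, y \in W & adj X x y]].

Lemma induced_vertices X (W : {set T}) x y :
  induced_adj X W x y ->
  (x \in vertices X :&: W) && (y \in vertices X :&: W).
Proof.
by case/and3P=> xW yW /adj_vertices/andP[xV yV]; rewrite !inE xV yV xW yW.
Qed.

Lemma induced_sym X (W : {set T}) : symmetric (induced_adj X W).
Proof. by move=> x y; rewrite /induced_adj /= adj_sym andbCA. Qed.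

Lemma induced_irr X (W : {set T}) : irreflexive (induced_adj X W).
Proof. by move=> x; rewrite /induced_adj /= adj_irr !andbF. Qed.

Definition induced X (W : {set T}) : graph T :=
  Graph (@induced_vertices X W) (@induced_sym X W) (@induced_irr X W).

Definition remove_isolated X : graph T :=
  induced X [set x | ~~ isolated X x].

Definition connected X : bool :=
  [forall x in vertices X, forall y in vertices X, connect (adj X) x y].

(* The least length (number of edges) of a walk from x to y.  A shortest walk
   is a path, so lengths below #|T| suffice; if y is not reachable from x the
   value is #|T|. *)
Definition dist X x y : nat :=
  find (fun n => [exists p : n.-tuple T, path (adj X) x p && (last x p == y)])
       (iota 0 #|T|).

Lemma dist_le X x (p : seq T) :
  path (adj X) x p -> dist X x (last x p) <= size p.
Proof.
move=> xp; rewrite /dist.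
have [lt_p | le_p] := ltnP (size p) #|T|; last first.
  by apply: leq_trans le_p; rewrite -[leqRHS](size_iota 0) find_size.
rewrite leqNgt; apply/negP=> /(before_find 0); rewrite nth_iota // add0n.
by move/existsP; case; exists (in_tuple p); rewrite /= xp eqxx.
Qed.

Lemma dist_connect X x y :
  connect (adj X) x y ->
  exists p, [/\ path (adj X) x p, last x p = y & size p = dist X x y].
Proof.
case/connectP=> p0 xp0 def_y; case/shortenP: xp0 def_y => p xp Up _ def_y.
have lt_p: size p < #|T| by rewrite -[_.+1](card_uniqP Up) max_card.
pose a n := [exists q : n.-tuple T, path (adj X) x q && (last x q == y)].
have a_p: has a (iota 0 #|T|).
  apply/hasP; exists (size p); first by rewrite mem_iota.
  by apply/existsP; exists (in_tuple p); rewrite /= xp -def_y eqxx.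
have lt_d: dist X x y < #|T|.
  by move: a_p; rewrite has_find size_iota.
have := nth_find 0 a_p; rewrite nth_iota // add0n => /existsP[q].
by case/andP=> xq /eqP def_q; exists q; rewrite xq def_q size_tuple.
Qed.

(* Meaningful for connected graphs only, see [dist]. *)
Definition diameter X : nat :=
  \max_(x in vertices X) \max_(y in vertices X) dist X x y.

End GraphNotions.

Section InvariablyGeneratingGraph.

Local Open Scope group_scope.

Variable gT : finGroupType.
Implicit Types (G : {group gT}) (X C D : {set gT}).

Definition inv_gen G X : bool :=
  (X \subset G) &&
  [forall g : {ffun gT -> gT},
     [forall x in X, g x \in G] ==> (<<[set x ^ g x | x in X]>> == G)].

Definition Lambda_vertices G : {set {set gT}} := classes G :\ [set 1].

(* [exists] may be read as [forall]: see [Lambda_adj_class]. *)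
Definition Lambda_adj G : rel {set gT} :=
  [rel C D | [&& C \in Lambda_vertices G, D \in Lambda_vertices G, C != D
               & [exists x in C, exists y in D, inv_gen G [set x; y]]]].

Lemma Lambda_adj_vertices G C D :
  Lambda_adj G C D ->
  (C \in Lambda_vertices G) && (D \in Lambda_vertices G).
Proof. by case/and4P=> -> ->. Qed.

Lemma Lambda_adj_sym G : symmetric (Lambda_adj G).
Proof.
suff imp C D : Lambda_adj G C D -> Lambda_adj G D C.
  by move=> C D; apply/idP/idP; apply: imp.
case/and4P=> VC VD neqCD /exists_inP[x xC /exists_inP[y yD xyG]].
rewrite /Lambda_adj /= VC VD eq_sym neqCD /=; apply/exists_inP; exists y => //.
by apply/exists_inP; exists x; rewrite // setUC.
Qed.

Lemma Lambda_adj_irr G : irreflexive (Lambda_adj G).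
Proof. by move=> C; rewrite /Lambda_adj /= eqxx !andbF. Qed.

Definition Lambda G : graph {set gT} :=
  Graph (@Lambda_adj_vertices G) (@Lambda_adj_sym G) (@Lambda_adj_irr G).

Definition Xi G : graph {set gT} := remove_isolated (Lambda G).

Lemma inv_gen2P G x y :
    x \in G -> y \in G -> x != y ->
  reflect (forall a b, a \in G -> b \in G -> <<[set x ^ a; y ^ b]>> = G)
          (inv_gen G [set x; y]).
Proof.
move=> Gx Gy neq_xy; apply: (iffP andP) => [[_ /forallP xyG] a b Ga Gb | xyG].
  have /implyP := xyG [ffun z => if z == x then a else b].
  rewrite imsetU1 imset_set1 !ffunE eqxx [y == x]eq_sym (negPf neq_xy) => xyG1.
  by apply/eqP/xyG1/forall_inP=> z _; rewrite ffunE; case: ifP.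
split; first by rewrite subUset !sub1set Gx.
apply/forallP=> g; apply/implyP=> /forall_inP Gg.
by rewrite imsetU1 imset_set1 xyG // Gg // !inE eqxx ?orbT.
Qed.

Lemma Lambda_adj_class G x y :
    x \in G -> y \in G -> x != 1 -> y != 1 -> x ^: G != y ^: G ->
  adj (Lambda G) (x ^: G) (y ^: G) = inv_gen G [set x; y].
Proof.
move=> Gx Gy ntx nty neqC.
have neq z t : z \in x ^: G -> t \in y ^: G -> z != t.
  move=> xz yt; apply: contraNneq neqC => def_z.
  by rewrite -(class_eqP xz) def_z (class_eqP yt).
have V z : z \in G -> z != 1 -> z ^: G \in Lambda_vertices G.
  move=> Gz ntz; rewrite !inE mem_classes // andbT.
  by apply: contraNneq ntz => zG1; rewrite -in_set1 -zG1 class_refl.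
rewrite /= /Lambda_adj /= !V // neqC /=; apply/exists_inP/idP=> [[_ /imsetP[a Ga ->]] | xyG].
  case/exists_inP=> _ /imsetP[b Gb ->] /inv_gen2P xyG.
  apply/inv_gen2P=> // [|c d Gc Gd]; first by rewrite neq ?class_refl.
  rewrite -(mulKVg a c) -(mulKVg b d) !(conjgM _ a) !(conjgM _ b).
  by rewrite xyG ?groupJ ?groupM ?groupV // neq ?memJ_class.
exists x; first exact: class_refl.
by apply/exists_inP; exists y => //; apply: class_refl.
Qed.

End InvariablyGeneratingGraph.

(* Main.v *)
Require Import Defs.
From mathcomp Require Import all_boot all_fingroup cyclic pgroup alt.

(* Conjugacy classes of S_8 are named by their cycle shapes.  Two classes that
   meet conjugates of one maximal subgroup are not adjacent; comparing shapes
   with the maximal subgroups leaves eight pairs.  Each of them invariably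
   generates: up to conjugation one generator x is fixed, and for every y in
   the other class <x, y> is transitive, has order divisible by 5 or 7 (hence
   is primitive, as 8 < 2 * 5) and contains a transposition, so it is S_8.
   The eight edges form a tree on nine vertices; all are within distance 3 of
   the class of shape (5, 3), while (4, 4) and (3, 3, 2) are at distance 6. *)

Set Implicit Arguments.
Unset Strict Implicit.
Unset Printing Implicit Defensive.

Local Open Scope group_scope.

(** * Groups containing a transposition *)

(** The complement of the fixed-point set has two elements and is stable under [z]. *)
Lemma transposition_of_card_fix (T : finType) (z : {perm T}) :
  #|[set x | z x == x]|.+2 = #|T| -> exists a b, a != b /\ z = tperm a b.
Proof.
move=> fix_z; pose S := ~: [set x | z x == x].
have /cards2P[a [b [neq_ab defS]]]: #|S| == 2.
  by rewrite -(eqn_add2l #|[set x | z x == x]|) cardsC -fix_z addn2.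
have inS x : (z x != x) = (x == a) || (x == b).
  by have := in_set2 x a b; rewrite -defS !inE.
have zS x : z x != x -> z x \in [set a; b].
  by move=> zx; rewrite !inE -inS (inj_eq perm_inj).
exists a, b; split=> //; apply/permP=> x; case: tpermP => [->|->|/eqP xa /eqP xb].
- have za: z a != a by rewrite inS eqxx.
  by have := zS a za; rewrite !inE (negPf za) => /eqP.
- have zb: z b != b by rewrite inS eqxx orbT.
  by have := zS b zb; rewrite !inE (negPf zb) orbF => /eqP.
by apply/eqP; move: (inS x); rewrite (negPf xa) (negPf xb) => /negbFE.
Qed.

Section TranspositionPrimeOrder.

Variables (T : finType) (H : {group {perm T}}) (p : nat).
Hypotheses (p_pr : prime p) (pH : p %| #|H|) (ltTp : #|T| < p.*2).
Hypothesis trH : forall x y, exists2 h : {perm T}, h \in H & h x = y.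

(* An H-invariant equivalence relation: an element of order p forces a class of
   at least p > #|T| / 2 points, and the classes have equal size. *)
Let R : rel T := fun x y => tperm x y \in H.

Let Rrefl x : R x x. Proof. by rewrite /R tperm1 group1. Qed.

Let Rsym x y : R x y -> R y x. Proof. by rewrite /R tpermC. Qed.

Let Rtrans y x z : R x y -> R y z -> R x z.
Proof.
rewrite /R; have [-> //|nxy] := eqVneq x y; have [<- //|nyz] := eqVneq y z.
have [-> | nxz] := eqVneq x z; first by rewrite tperm1 group1.
move=> Hxy Hyz; rewrite -(tpermJ_tperm nyz nxz).
by rewrite groupJ // tpermC.
Qed.

Let RH h x y : h \in H -> R (h x) (h y) = R x y.
Proof. by move=> Hh; rewrite /R -tpermJ groupJr. Qed.

Lemma sym_of_transposition_prime (z : {perm T}) :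
  z \in H -> #|[set x | z x == x]|.+2 = #|T| -> H = [set: {perm T}]%G.
Proof.
move=> Hz /transposition_of_card_fix[a [b [neq_ab def_z]]].
have Rab: R a b by rewrite /R -def_z.
have [s Hs os] := Cauchy p_pr pH.
have Hsn n : s ^+ n \in H by apply: groupX.
have [i nsi]: exists i, s i != i.
  apply/existsP; rewrite -negb_forall; apply: contraTN p_pr => /forallP s1.
  by rewrite -os (_ : s = 1) ?order1 //; apply/permP=> x; rewrite perm1; apply/eqP.
have [j neq_ij Rij]: exists2 j, i != j & R i j.
  have [h Hh def_i] := trH a i; exists (h b); rewrite -def_i ?RH //.
  by rewrite (inj_eq perm_inj).
(* An exponent prime to [p] is invertible modulo the order of [s], so what is stable under [s ^+ n]
   is stable under [s]. *)
have pow_s n : ~~ (p %| n) -> exists m, (s ^+ n) ^+ m = s.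
  move=> pn; exists (expg_invn <[s]> n); apply: expgK; last exact: cycle_id.
  by rewrite -[#|_|]/#[s] os prime_coprime.
have lt_dvd m n : m < n -> n < p -> ~~ (p %| n - m).
  by move=> ltmn ltnp; rewrite gtnNdvd ?subn_gt0 // (leq_ltn_trans (leq_subr _ _)).
have Rsi: R i (s i).
  (* Otherwise the images of [i] and [j] under the [p] powers of [s] are [p.*2] distinct points: a
     coincidence between different powers would make some generator of [<[s]>] keep the class of
     [i]. *)
  apply: contraLR ltTp => nRsi; rewrite -leqNgt.
  have apart m n x y : m < n -> n < p -> R i x -> R i y ->
      (s ^+ m) x <> (s ^+ n) y.
    move=> ltmn ltnp Rix Riy; rewrite -(subnK (ltnW ltmn)) expgD permM.
    move/perm_inj=> def_x; case/negP: nRsi.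
    set t := s ^+ (n - m) in def_x.
    have Rti: R i (t i).
      by apply: Rtrans Rix _; rewrite def_x RH ?Hsn //; apply: Rsym.
    have [k def_s] := pow_s _ (lt_dvd _ _ ltmn ltnp); rewrite -def_s -/t.
    elim: (k) => [|l IHl]; first by rewrite expg0 perm1.
    by rewrite expgSr permM; apply: Rtrans Rti _; rewrite RH ?Hsn.
  pose f (u : 'I_p * bool) := (s ^+ u.1) (if u.2 then j else i).
  have injf: injective f.
    have Ri (e : bool) : R i (if e then j else i) by case: e.
    case=> m d [n e]; rewrite /f /=; case: (ltngtP m n) => [lt|lt|/val_inj <-].
    - by move/(apart _ _ _ _ lt (ltn_ord n) (Ri d) (Ri e)).
    - by move/esym/(apart _ _ _ _ lt (ltn_ord m) (Ri e) (Ri d)).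
    move/perm_inj=> def_ij; congr (_, _); move: def_ij neq_ij.
    by case: d e => [] [] // ->; rewrite eqxx.
  by rewrite -muln2 -card_bool -(card_ord p) -card_prod -(card_imset _ injf) max_card.
(* The [s]-orbit of [i] puts [p] points in its class. All classes have the same size by
   transitivity, so there is no room for a second one. *)
pose K x := [set y | R x y].
have leKi: p <= #|K i|.
  pose f (m : 'I_p) := (s ^+ m) i.
  have fix_s n : (s ^+ n) i = i -> p %| n.
    apply: contra_eqT => /pow_s[m def_s]; apply: contra nsi => /eqP sni.
    rewrite -def_s; elim: (m) => [|k IHk]; first by rewrite expg0 perm1.
    by rewrite expgS permM sni.
  have injf: injective f.
    have neqf (m n : 'I_p) : m < n -> f m <> f n.
      move=> lt; rewrite /f -(subnK (ltnW lt)) expgD permM => /perm_inj/esym/fix_s.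
      exact/negP/lt_dvd.
    by move=> m n; case: (ltngtP m n) => [/neqf//|/neqf/nesym//|/val_inj].
  rewrite -[leqLHS]card_ord -(card_imset _ injf) subset_leq_card //.
  apply/subsetP=> _ /imsetP[m _ ->]; rewrite inE /f.
  elim: (m : nat) => [|k IHk]; first by rewrite expg0 perm1.
  by rewrite expgSr permM; apply: Rtrans Rsi _; rewrite RH.
have Ri k : R i k.
  have [h Hh def_k] := trH i k; have cardK: #|K k| = #|K i|.
    rewrite -[RHS](card_imset _ (@perm_inj _ h)); congr #|pred_of_set _|.
    apply/setP=> y; rewrite -[y](permKV h) mem_imset; last exact: perm_inj.
    by rewrite !inE -def_k RH.
  have: K i :&: K k != set0.
    rewrite setI_eq0; apply: contraL ltTp => dis; rewrite -leqNgt -addnn.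
    have:= max_card [in K i :|: K k]; apply: leq_trans.
    rewrite (eq_card (B := K i :|: K k)) // cardsU (disjoint_setI0 dis) cards0.
    by rewrite subn0 cardK leq_add.
  by case/set0Pn=> y; rewrite !inE => /andP[Riy /Rsym]; apply: Rtrans.
have allH x y : tperm x y \in H by apply: (@Rtrans i); [apply: Rsym | ]; apply: Ri.
apply/val_inj/setP=> q; rewrite inE; have [ts -> _] := prod_tpermP q.
by apply: group_prod.
Qed.

End TranspositionPrimeOrder.

(** * Permutations of eight points as lists of values *)

(* Unlike [all] and [has], these stop early under call-by-value evaluation. *)
Fixpoint lall T (a : pred T) s :=
  if s is x :: s' then if a x then lall a s' else false else true.
Fixpoint lhas T (a : pred T) s :=
  if s is x :: s' then if a x then true else lhas a s' else false.

Lemma lallE T (a : pred T) s : lall a s = all a s.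
Proof. by elim: s => //= x s ->. Qed.

Lemma lhasE T (a : pred T) s : lhas a s = has a s.
Proof. by elim: s => //= x s ->. Qed.

Definition pts := iota 0 8.
(** Entrywise application of [t]: on value lists this is the product taken from left to right, and
    [s] may also be a single cycle. *)
Definition code_mul (s t : seq nat) := [seq nth 0 t i | i <- s].
Definition code_pow s k := iter k (code_mul s) pts.
Definition fixn s := count (fun i => nth 0 s i == i) pts.

Definition code (p : 'S_8) : seq nat := [seq val (p i) | i <- enum 'I_8].
(** The value 1 is a default for lists that are not permutations of [pts]. *)
Definition decode s : 'S_8 := odflt 1 [pick p | code p == s].

Lemma ptsE : pts = map val (enum 'I_8).
Proof. by rewrite val_enum_ord. Qed.

Lemma nth_code p (i : 'I_8) : nth 0 (code p) i = p i.
Proof. by rewrite (nth_map i) ?size_enum_ord // nth_ord_enum. Qed.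

Lemma code_inj : injective code.
Proof. by move=> p q eq_pq; apply/permP=> i; apply/val_inj; rewrite /= -!nth_code eq_pq. Qed.

Lemma code1 : code 1 = pts.
Proof. by rewrite ptsE; apply: eq_map => i; rewrite perm1. Qed.

Lemma codeM p q : code (p * q) = code_mul (code p) (code q).
Proof. by rewrite /code_mul -map_comp; apply: eq_map => i /=; rewrite nth_code permM. Qed.

Lemma codeX p k : code (p ^+ k) = code_pow (code p) k.
Proof. by elim: k => [|k IHk]; rewrite ?code1 // expgS codeM IHk. Qed.

Lemma code_perm p : perm_eq (code p) pts.
Proof.
apply: uniq_perm; rewrite ?iota_uniq //.
  by rewrite map_inj_uniq ?enum_uniq //; apply: inj_comp val_inj perm_inj.
move=> k; rewrite ptsE; apply/mapP/mapP=> [[i _ ->]|[i _ ->]].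
  by exists (p i); rewrite ?mem_enum.
by exists (p^-1 i); rewrite ?mem_enum ?permKV.
Qed.

Lemma size_code p : size (code p) = 8.
Proof. by rewrite size_map size_enum_ord. Qed.

Lemma decodeK s : perm_eq s pts -> code (decode s) = s.
Proof.
move=> sP; have sz: size s = 8 by rewrite (perm_size sP).
have lt_s (i : 'I_8) : nth 0 s i < 8.
  by rewrite -[_ < 8](mem_iota 0 8) -(perm_mem sP) mem_nth ?sz.
pose f i := Ordinal (lt_s i).
have injf: injective f.
  move=> i j [/eqP]; rewrite nth_uniq ?sz ?(perm_uniq sP) ?iota_uniq //.
  by move/eqP/val_inj.
rewrite /decode; case: pickP => [p /eqP//|/(_ (perm injf))/eqP[]].
apply: (@eq_from_nth _ 0) => [|i]; rewrite size_code ?sz // => lti.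
by rewrite (nth_code _ (Ordinal lti)) permE.
Qed.

Lemma fixn_code p : fixn (code p) = #|[set i | p i == i]|.
Proof.
rewrite /fixn ptsE count_map cardsE cardE size_filter enumT.
by apply: eq_count => i; rewrite /= nth_code.
Qed.

Lemma fixnJ p g : fixn (code (p ^ g)) = fixn (code p).
Proof.
rewrite !fixn_code -[RHS](card_imset _ (@perm_inj _ g)).
congr #|pred_of_set _|; apply/setP=> i; rewrite -[i](permKV g) mem_imset; last exact: perm_inj.
by rewrite !inE permJ (inj_eq perm_inj).
Qed.

(* In degree 8 the numbers of fixed points of the first five powers determine
   the cycle shape. *)
Definition same_profile s :=
  let f := [seq fixn (code_pow s k.+1) | k <- iota 0 5] in
  fun t => lall (fun k => fixn (code_pow t k.+1) == nth 0 f k) (iota 0 5).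

Lemma same_profileJ p g : same_profile (code p) (code (p ^ g)).
Proof.
rewrite /same_profile lallE; apply/allP=> k; rewrite mem_iota => /andP[_ ltk].
by rewrite (nth_map 0) ?size_iota // nth_iota // -!codeX -conjXg fixnJ.
Qed.

(** * Testing generation by computation *)

(** Closure of the point 0 under the two maps. Until it is stable each round adds a point, so 7
    rounds give the whole orbit on 8 points. *)
Definition reach n s t :=
  iter n (fun X => undup (X ++ map (nth 0 s) X ++ map (nth 0 t) X)) [:: 0].

(* The exponent 15 is a multiple of every odd length of a cycle that can
   accompany a 2-cycle in degree 8. *)
Definition power_transposition s :=
  let s3 := code_mul s (code_mul s s) in let s6 := code_mul s3 s3 in
  fixn (code_mul (code_mul s6 s6) s3) == 6.

(** Words s^i t^j are tried first, and products of two such words only if none of these works. *)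
Definition word_transposition s t :=
  let ss := [seq code_pow s i | i <- pts] in let ts := [seq code_pow t i | i <- iota 0 6] in
  if lhas (fun a => lhas (fun b => power_transposition (code_mul a b)) ts) ss then true
  else lhas (fun a => lhas (fun b => let c := code_mul a b in
       lhas (fun a' => lhas (fun b' => power_transposition (code_mul c (code_mul a' b')))
         ts) ss) ts) ss.

(** All [u] with the profile of [t] are tested, among them all conjugates of [t]. *)
Definition generates_profile s t :=
  let P := same_profile t in
  lall (fun u => if P u then
                   if all (mem (reach 7 s u)) pts then word_transposition s u
                   else false
                 else true) (permutations pts).

Section Generation.

Variable H : {group 'S_8}.

Let codeH s := exists2 h, h \in H & code h = s.

Let codeH_comp s t : codeH s -> codeH t -> codeH (code_mul s t).
Proof. by move=> [g Hg <-] [h Hh <-]; exists (g * h); rewrite ?groupM ?codeM. Qed.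

Let codeH_pow s k : codeH s -> codeH (code_pow s k).
Proof. by move=> [g Hg <-]; exists (g ^+ k); rewrite ?groupX ?codeX. Qed.

Let codeH_power_transposition s : codeH s -> power_transposition s ->
  exists2 z, z \in H & #|[set i | z i == i]|.+2 = #|'I_8|.
Proof.
rewrite /power_transposition => Hs; set t := code_mul _ (code_mul s (code_mul s s)).
have [z Hz <- /eqP fix_z]: codeH t by do !apply: codeH_comp.
by exists z => //; rewrite -fixn_code fix_z card_ord.
Qed.

Lemma word_transpositionP s t : codeH s -> codeH t -> word_transposition s t ->
  exists2 z, z \in H & #|[set i | z i == i]|.+2 = #|'I_8|.
Proof.
move=> Hs Ht; rewrite /word_transposition.
set ss := map _ pts; set ts := map _ _.
have Hss a : a \in ss -> codeH a by case/mapP=> k _ ->; apply: codeH_pow.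
have Hts a : a \in ts -> codeH a by case/mapP=> k _ ->; apply: codeH_pow.
case: ifP => [+ _|_]; rewrite lhasE.
  case/hasP=> a /Hss Ha; rewrite lhasE => /hasP[b /Hts Hb].
  exact: codeH_power_transposition (codeH_comp Ha Hb).
case/hasP=> a /Hss Ha; rewrite lhasE => /hasP[b /Hts Hb].
rewrite lhasE => /hasP[c /Hss Hc]; rewrite lhasE => /hasP[d /Hts Hd].
exact: codeH_power_transposition (codeH_comp (codeH_comp Ha Hb) (codeH_comp Hc Hd)).
Qed.

Lemma reach_trans s t : codeH s -> codeH t -> all (mem (reach 7 s t)) pts ->
  forall i j : 'I_8, exists2 h : 'S_8, h \in H & h i = j.
Proof.
move=> [g Hg <-] [h Hh <-] /allP reach_pts.
have reachH n k : k \in reach n (code g) (code h) ->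
    exists2 r : 'S_8, r \in H & val (r (ord0 : 'I_8)) = k.
  rewrite /reach; elim: n k => [|n IHn] k.
    by rewrite inE => /eqP->; exists 1; rewrite ?perm1.
  rewrite iterS mem_undup !mem_cat => /or3P[/IHn//||] /mapP[l /IHn[r Hr <-] ->].
    by exists (r * g); rewrite ?groupM // nth_code permM.
  by exists (r * h); rewrite ?groupM // nth_code permM.
have orb0 (i : 'I_8) : exists2 r : 'S_8, r \in H & r (ord0 : 'I_8) = i.
  have [|r Hr /val_inj def_i] := reachH 7 i; last by exists r.
  by apply: reach_pts; rewrite mem_iota ltn_ord.
move=> i j; have [[u Hu <-] [v Hv <-]] := (orb0 i, orb0 j).
by exists (u^-1 * v); rewrite ?groupM ?groupV // permM permK.
Qed.

End Generation.

(** Since [code (y ^ g)] is among the lists tested, [x] and [y ^ g] generate a transitive group that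
    contains a transposition and has order divisible by [p]. *)
Lemma generates_profileP x y g p :
    generates_profile (code x) (code y) -> prime p -> p %| #[x] \/ p %| #[y] ->
  8 < p.*2 -> <<[set x; y ^ g]>> = [set: 'S_8].
Proof.
rewrite /generates_profile lallE => /allP/(_ (code (y ^ g))).
rewrite mem_permutations code_perm same_profileJ => /(_ isT) + p_pr p_xy lt8p.
pose H := <<[set x; y ^ g]>>%G; have [Hx Hy]: x \in H /\ y ^ g \in H.
  by split; rewrite mem_gen // !inE eqxx ?orbT.
have pH: p %| #|H|.
  by case: p_xy => /dvdn_trans; apply; rewrite -?(orderJ y g) order_dvdG.
case: ifP => // /(reach_trans (H := H)) trH.
have Hcx: exists2 h, h \in H & code h = code x by exists x.
have Hcy: exists2 h, h \in H & code h = code (y ^ g) by exists (y ^ g).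
case/(word_transpositionP Hcx Hcy)=> z Hz fix_z.
have lt8: #|'I_8| < p.*2 by rewrite card_ord.
have := sym_of_transposition_prime p_pr pH lt8 (trH Hcx Hcy) Hz fix_z.
by move/(congr1 val).
Qed.

(** * Cycle shapes *)

(* Partitions of n into parts of size at most k; f is fuel. *)
Fixpoint parts f n k : seq (seq nat) :=
  if n is 0 then [:: [::]] else
  if f is f'.+1 then [seq a :: m | a <- iota 1 (minn n k), m <- parts f' (n - a) a]
  else [::].

Lemma mem_parts f n k m :
  n <= f -> sumn m = n -> path geq k m -> 0 \notin m -> m \in parts f n k.
Proof.
elim: f n k m => [|f IHf] [|n] k m //=.
- by case: m => //= a m _ /eqP; rewrite addn_eq0 inE => /andP[/eqP->].
- by case: m => //= a m _ /eqP; rewrite addn_eq0 inE => /andP[/eqP->].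
case: m => //= a m le_nf def_n /andP[le_ak am]; rewrite inE negb_or eq_sym -lt0n => /andP[a0 m0].
apply/allpairsPdep; exists a, m; split=> //.
  by rewrite mem_iota a0 add1n ltnS leq_min le_ak andbT -def_n leq_addr.
apply: IHf => //; last by rewrite -def_n addKn.
by rewrite leq_subLR (leq_trans le_nf) // -add1n leq_add2r.
Qed.

Definition shapes := parts 8 8 8.

(** The points are cut into intervals of lengths [m]; rotating an interval by one gives the values
    of the cycle that moves each of its points to the next. *)
Definition std_code m := flatten (map (rot 1%N) (reshape m pts)).
Definition shape_perm m : 'S_8 := decode (std_code m).
Definition shape_class m := shape_perm m ^: [set: 'S_8].

Lemma code_shape_perm m : m \in shapes -> code (shape_perm m) = std_code m.
Proof.
have: all (fun m => perm_eq (std_code m) pts) shapes by vm_compute.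
by move/allP=> sP /sP; apply: decodeK.
Qed.

(** Writing the cycles of [p] one after another defines a relabelling [g] that takes the intervals
    of the standard permutation to these cycles, hence conjugates it to [p]. *)
Lemma shape_class_of_cycles p css :
    perm_eq (flatten css) pts -> shape css \in shapes ->
    {in css, forall c, code_mul c (code p) = rot 1%N c} ->
  p \in shape_class (shape css).
Proof.
move=> flatP sP cyc; pose g := decode (flatten css).
suff eq_gp: shape_perm (shape css) * g = g * p.
  by apply/imsetP; exists g; rewrite ?inE // conjgE eq_gp mulKg.
apply: code_inj; rewrite !codeM code_shape_perm // decodeK // /code_mul /std_code !map_flatten.
congr flatten; have sz: size (flatten css) = 8 by rewrite (perm_size flatP).
have <-: [seq rot 1%N c | c <- css] = [seq code_mul c (code p) | c <- css].
  by apply/eq_in_map=> c /cyc.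
rewrite -[in RHS](flattenK css) -[in RHS](mkseq_nth 0 (flatten css)) sz.
by rewrite -map_reshape -!map_comp; apply: eq_map => c; rewrite /= map_rot.
Qed.

Lemma cycle_decomposition (T : finType) (p : {perm T}) :
  exists2 css, perm_eq (flatten css) (enum T)
             & {in css, forall c, c != [::] /\ map p c = rot 1%N c}.
Proof.
pose cyc (A : {set T}) := if [pick x in A] is Some x then traject p x #|A| else [::].
pose css := [seq cyc A | A <- enum (porbits p)].
have cycP A : A \in porbits p -> exists2 x, A = porbit p x & cyc A = traject p x #|A|.
  case/imsetP=> y _ defA; rewrite /cyc; case: pickP => [x Ax|/(_ y)].
    by exists x => //; apply/eqP; rewrite defA eq_sym eq_porbit_mem -defA.
  by rewrite defA porbit_id.
have porb x : porbit p x \in porbits p by apply: imset_f.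
have mem_css x : x \in flatten css.
  apply/flattenP; exists (cyc (porbit p x)).
    by apply: map_f; rewrite mem_enum.
  have [y defA ->] := cycP _ (porb x).
  by rewrite defA -porbit_traject -defA porbit_id.
exists css.
  apply: uniq_perm; rewrite ?enum_uniq //; last by move=> x; rewrite mem_css mem_enum.
  (* The list covers [T], and its length is at most [#|T|] because the orbits partition [T]; hence
     it has no repetitions. *)
  apply: (leq_size_uniq (enum_uniq T)) => [x _|]; first exact: mem_css.
  rewrite size_flatten /shape -map_comp -cardE -cardsT.
  have /card_partition->: partition (porbits p) [set: T].
    have ->: porbits p = [set orbit 'P <[p]> x | x in [set: T]].
      by rewrite -porbitE; apply/setP=> A; apply/imsetP/imsetP=> [[x _ ->]|[x _ ->]]; exists x.
    by apply: orbit_partition; apply/actsP=> q _ x; rewrite !inE.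
  rewrite sumnE big_map big_enum leq_sum // => A /cycP[x -> /= ->].
  by rewrite size_traject.
move=> c /mapP[A]; rewrite mem_enum => /cycP[x -> ->] ->.
have: 0 < #|porbit p x| by apply/card_gt0P; exists x; apply: porbit_id.
have := iter_porbit p x; case: #|porbit p x| => // n px _; split=> //.
(* After a full orbit length the trajectory returns to [x], so applying [p] rotates it. *)
have ->: rot 1%N (traject p x n.+1) = traject p (p x) n.+1.
  by rewrite trajectS rot1_cons trajectSr -iterSr px.
by elim: n.+1 (x) => //= k IHk y; rewrite IHk.
Qed.

Lemma class_shape p : exists2 m, m \in shapes & p \in shape_class m.
Proof.
have [css0 flat0 cyc0] := cycle_decomposition p.
(* Sorting the cycles by non-increasing length makes the shape one of the listed partitions of 8. *)
pose css := sort (fun c d => size d <= size c) [seq map val c | c <- css0].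
have mem_css: css =i [seq map val c | c <- css0] by apply: mem_sort.
have flatP: perm_eq (flatten css) pts.
  rewrite (perm_trans (perm_flatten (permEl (perm_sort _ _)))) // ptsE.
  by rewrite -map_flatten perm_map.
have cyc: {in css, forall c, code_mul c (code p) = rot 1%N c}.
  move=> _ /[!mem_css] /mapP[c /cyc0[_ eq_pc] ->].
  rewrite -map_rot -eq_pc /code_mul -!map_comp.
  by apply: eq_map => i; rewrite /= nth_code.
suff sP: shape css \in shapes by exists (shape css); last exact: shape_class_of_cycles.
have sum8: sumn (shape css) = 8 by rewrite -size_flatten (perm_size flatP).
apply: mem_parts => //.
  have: sorted geq (shape css).
    by rewrite sorted_map sort_sorted // => c d; apply: leq_total.
  by case: (shape css) sum8 => //= a m <- ->; rewrite leq_addr.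
apply/mapP=> [[_ /[!mem_css] /mapP[c /cyc0[c0 _] ->]]].
by move/esym/eqP; rewrite size_map size_eq0 (negPf c0).
Qed.

(** * Maximal subgroups *)

(** Each block only has to be mapped into some block. This is closed under products, so in a finite
    group it already defines a subgroup. *)
Definition preserves (F : seq (seq nat)) s :=
  lall (fun B => lhas (fun B' : seq nat => all (fun i => nth 0 s i \in B') B) F) F.

Lemma preservesP F (p : 'S_8) : all (all (fun i => i < 8)) F ->
  reflect (forall B, B \in F -> exists2 B', B' \in F &
             forall i : 'I_8, nat_of_ord i \in B -> nat_of_ord (p i) \in B')
          (preserves F (code p)).
Proof.
move=> ltF; rewrite /preserves lallE; apply: (iffP allP) => pF B FB.
  have := pF B FB; rewrite lhasE => /hasP[B' FB' /allP pB]; exists B' => // i Bi.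
  by rewrite -nth_code pB.
have [B' FB' pB] := pF B FB; rewrite lhasE; apply/hasP; exists B' => //.
apply/allP=> i Bi; have lti: i < 8 by apply: (allP (allP ltF B FB)).
by rewrite (nth_code p (Ordinal lti)) pB.
Qed.

(* Found by computer search: for distinct nontrivial shapes that are neither
   both even nor joined in [edges], some family has for each of the two shapes
   a relabelling by a frame that the standard permutation preserves. *)
Definition frames : seq (seq nat) :=
  [:: [:: 7; 6; 5; 4; 0; 2; 1; 3]; [:: 2; 6; 0; 4; 1; 5; 7; 3];
      [:: 5; 6; 4; 3; 2; 7; 1; 0]; [:: 0; 3; 1; 4; 5; 2; 7; 6]; pts]%N.

Definition relabel (g : seq nat) (F : seq (seq nat)) := [seq [seq nth 0 g i | i <- B] | B <- F].

Lemma preserves_conj F (h p : 'S_8) : all (all (fun i => i < 8)) F ->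
  preserves (relabel (code h) F) (code p) -> preserves F (code (p ^ h^-1)).
Proof.
move=> ltF.
have memB B (i : 'I_8) : B \in F ->
    (nat_of_ord (h i) \in [seq nth 0 (code h) k | k <- B]) = (nat_of_ord i \in B).
  move=> FB; apply/mapP/idP=> [[k Bk]|Bi]; last by exists (nat_of_ord i) => //; rewrite nth_code.
  have ltk: k < 8 by apply: (allP (allP ltF B FB)).
  by rewrite (nth_code h (Ordinal ltk)) => /val_inj/perm_inj->.
have ltF': all (all (fun i => i < 8)) (relabel (code h) F).
  apply/allP=> _ /mapP[B FB ->]; apply/allP=> _ /mapP[k Bk ->].
  have ltk: k < 8 by apply: (allP (allP ltF B FB)).
  by rewrite (nth_code h (Ordinal ltk)).
move/(preservesP p ltF')=> pF; apply/(preservesP _ ltF)=> B FB.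
have [|_ /mapP[B' FB' ->] pB] := pF [seq nth 0 (code h) k | k <- B]; first exact: map_f.
exists B' => // i Bi; rewrite -memB // conjgE invgK !permM permKV.
by apply: pB; rewrite memB.
Qed.

Lemma preserves_gen F (p q : 'S_8) : all (all (fun i => i < 8)) F ->
    preserves F (code p) -> preserves F (code q) ->
    <<[set p; q]>> = [set: 'S_8] ->
  forall r, preserves F (code r).
Proof.
move=> ltF pF qF gen_pq r; pose K := [set r | preserves F (code r)].
have gK: group_set K.
  apply/group_setP; split=> [|u v]; rewrite !inE.
    by apply/preservesP => // B FB; exists B => // i; rewrite perm1.
  move=> /(preservesP _ ltF) uF /(preservesP _ ltF) vF; apply/preservesP=> // B.
  move=> /uF[B' /vF[B'' FB'' vB'] uB].
  by exists B'' => // i /uB /vB'; rewrite permM.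
have: r \in <<[set p; q]>> by rewrite gen_pq inE.
have/subsetP sK: <<[set p; q]>> \subset Group gK.
  by rewrite gen_subG; apply/subsetP=> x; rewrite !inE => /orP[]/eqP->.
by move/sK; rewrite inE.
Qed.

(* The base blocks are the lines of the Fano plane on Z/7 with the point at
   infinity 7 added, their complements, and the images of both under i -> -i. *)
Definition planes : seq (seq nat) :=
  [seq [seq if i < 7 then (i + k) %% 7 else i | i <- B]
     | B <- [:: [:: 1; 2; 4; 7]; [:: 0; 3; 5; 6]; [:: 3; 5; 6; 7]; [:: 0; 1; 2; 4]]%N,
       k <- iota 0 7].

(* Families whose stabilisers represent the maximal subgroups of S_8 other
   than A_8: S_7, S_6 x S_2, S_5 x S_3, S_4 wr S_2, S_2 wr S_4, PGL(2, 7). *)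
Definition families : seq (seq (seq nat)) :=
  [:: [:: [:: 0]]; [:: [:: 0; 1]]; [:: [:: 0; 1; 2]];
      [:: [:: 0; 1; 2; 3]; [:: 4; 5; 6; 7]];
      [:: [:: 0; 1]; [:: 2; 3]; [:: 4; 5]; [:: 6; 7]]; planes]%N.

(** A sufficient test that the class of shape [m] meets the stabiliser of [F]: only the relabellings
    in [frames] are tried. *)
Definition meets F m := has (fun g => preserves (relabel g F) (std_code m)) frames.

Lemma meetsP F m : F \in families -> m \in shapes -> meets F m ->
  exists a, preserves F (code (shape_perm m ^ a)).
Proof.
move=> famF mS /hasP[g gP]; rewrite -code_shape_perm //.
have /allP/(_ g gP) gpts: all (fun g => perm_eq g pts) frames by vm_compute.
rewrite -(decodeK gpts) => /preserves_conj pF; exists (decode g)^-1; apply: pF.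
by have/allP/(_ F famF): all (all (all (fun i => i < 8))) families by vm_compute.
Qed.

Lemma meets_not_gen F m1 m2 :
    F \in families -> m1 \in shapes -> m2 \in shapes -> meets F m1 -> meets F m2 ->
  exists a b, <<[set shape_perm m1 ^ a; shape_perm m2 ^ b]>> <> [set: 'S_8].
Proof.
move=> famF m1S m2S /(meetsP famF m1S)[a aF] /(meetsP famF m2S)[b bF].
exists a, b => gen_ab.
have/allP/(_ F famF) ltF: all (all (all (fun i => i < 8))) families by vm_compute.
(* No family is preserved by the whole of S_8, so its stabiliser is proper. *)
have/allP/(_ F famF)/hasP[s]:
    all (fun F => has (fun s => ~~ preserves F s) (map std_code shapes)) families.
  by vm_compute.
by case/mapP=> m mS ->; rewrite -code_shape_perm // (preserves_gen ltF aF bF gen_ab).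
Qed.

(** * Even shapes and excluded pairs *)

Definition swap i := [seq if k == i then i.+1 else if k == i.+1 then i else k | k <- pts].

(** [scanl] lists the ends of the intervals, so the indices kept are those with [i] and [i.+1] in
    one interval. Taken in decreasing order, the adjacent transpositions multiply to the standard
    permutation. *)
Definition swaps m := rev [seq i <- iota 0 7 | i.+1 \notin scanl addn 0 m].

(** The factorisation into adjacent transpositions is verified along with the parity of their
    number. *)
Definition even_shape m :=
  let ts := swaps m in
  ~~ odd (size ts) && (foldr (fun i => code_mul (swap i)) pts ts == std_code m).

Lemma even_shapeP m : m \in shapes -> even_shape m -> shape_perm m \in 'Alt_('I_8).
Proof.
move=> mS /andP[even_m /eqP def_m]; rewrite Alt_even.
pose t i : 'I_8 * 'I_8 := (inord i, inord i.+1).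
have ts_lt i : i \in swaps m -> i < 7.
  by rewrite mem_rev mem_filter mem_iota => /and3P[].
have def_perm: shape_perm m = \prod_(x <- map t (swaps m)) tperm x.1 x.2.
  apply: code_inj; rewrite code_shape_perm // -def_m big_map.
  elim: (swaps m) ts_lt => [|i ts IHts] ts_lt.
    by rewrite big_nil code1.
  rewrite big_cons codeM -IHts => [|j tsj]; last by rewrite ts_lt // inE tsj orbT.
  rewrite -[LHS]/(code_mul (swap i) _).
  have lti: i < 7 by rewrite ts_lt ?mem_head.
  congr code_mul; rewrite /swap ptsE -map_comp; apply: eq_map => k /=.
  have v0: nat_of_ord (inord i : 'I_8) = i by rewrite inordK // ltnW.
  have v1: nat_of_ord (inord i.+1 : 'I_8) = i.+1 by rewrite inordK.
  rewrite -{1}v0 -{2}v1 !val_eqE; case: tpermP => [->|->|/eqP/negPf-> /eqP/negPf-> //].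
    by rewrite eqxx v1.
  by rewrite -val_eqE /= v0 v1 gtn_eqF // eqxx.
rewrite def_perm odd_perm_prod ?size_map // all_map; apply/allP=> i /ts_lt lti.
by rewrite /= /dpair /= -val_eqE /= !inordK ?neq_ltn ?ltnSn // ltnW.
Qed.

Definition edges : seq (seq nat * seq nat) :=
  [:: ([:: 8], [:: 5; 3]); ([:: 8], [:: 5; 2; 1]); ([:: 8], [:: 5; 1; 1; 1]);
      ([:: 7; 1], [:: 4; 2; 2]); ([:: 7; 1], [:: 3; 3; 2]);
      ([:: 6; 1; 1], [:: 5; 3]); ([:: 5; 3], [:: 4; 2; 2]); ([:: 5; 2; 1], [:: 4; 4])]%N.

Definition edge m1 m2 := ((m1, m2) \in edges) || ((m2, m1) \in edges).

Definition one_shape := nseq 8 1%N.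

Lemma edge_of_gen m1 m2 :
    m1 \in shapes -> m2 \in shapes -> m1 != one_shape -> m2 != one_shape -> m1 != m2 ->
    (forall a b, <<[set shape_perm m1 ^ a; shape_perm m2 ^ b]>> = [set: 'S_8]) -> edge m1 m2.
Proof.
move=> m1S m2S nt1 nt2 neq_m gen.
have: [|| edge m1 m2, even_shape m1 && even_shape m2 |
          has (fun F => meets F m1 && meets F m2) families].
  have: all (fun m1 => all (fun m2 =>
     [|| m1 == one_shape, m2 == one_shape, m1 == m2, edge m1 m2, even_shape m1 && even_shape m2 |
          has (fun F => meets F m1 && meets F m2) families]) shapes) shapes by vm_compute.
  by move/allP/(_ _ m1S)/allP/(_ _ m2S); rewrite (negPf nt1) (negPf nt2) (negPf neq_m).
case/or3P=> // [/andP[ev1 ev2] | /hasP[F famF /andP[F1 F2]]].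
  have sA: <<[set shape_perm m1 ^ 1; shape_perm m2 ^ 1]>> \subset 'Alt_('I_8).
    rewrite gen_subG; apply/subsetP=> x /set2P[]->; rewrite conjg1.
      exact: even_shapeP.
    exact: even_shapeP.
  have := odd_tperm (ord0 : 'I_8) ord_max.
  have: tperm (ord0 : 'I_8) ord_max \in 'Alt_('I_8) by rewrite (subsetP sA) // gen inE.
  by rewrite Alt_even => /negPf->.
by have [a [b]] := meets_not_gen famF m1S m2S F1 F2.
Qed.

(** * Invariably generating pairs *)

Lemma generates_8_5 : generates_profile (std_code [:: 8]) (std_code [:: 5; 1; 1; 1])%N.
Proof. by vm_cast_no_check (erefl true). Qed.

Lemma generates_7_422 : generates_profile (std_code [:: 7; 1])%N (std_code [:: 4; 2; 2]).
Proof. by vm_cast_no_check (erefl true). Qed.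

Lemma generates_7_332 : generates_profile (std_code [:: 7; 1])%N (std_code [:: 3; 3; 2]).
Proof. by vm_cast_no_check (erefl true). Qed.

Lemma generates_53_422 : generates_profile (std_code [:: 5; 3]) (std_code [:: 4; 2; 2]).
Proof. by vm_cast_no_check (erefl true). Qed.

Lemma generates_6_53 : generates_profile (std_code [:: 6; 1; 1])%N (std_code [:: 5; 3]).
Proof. by vm_cast_no_check (erefl true). Qed.

Lemma generates_521_44 : generates_profile (std_code [:: 5; 2; 1])%N (std_code [:: 4; 4]).
Proof. by vm_cast_no_check (erefl true). Qed.

(** If [p] did not divide the order, this order, a divisor of [n * p], would divide [n]. *)
Lemma prime_dvd_order (gT : finGroupType) (x : gT) p n :
  prime p -> x ^+ n != 1 -> x ^+ (n * p) = 1 -> p %| #[x].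
Proof.
move=> p_pr xn /eqP; rewrite -order_dvdn => xnp; apply: contraR xn => p_x.
by rewrite -order_dvdn -(@Gauss_dvdl _ _ p) // coprime_sym prime_coprime.
Qed.

(* Among the cycle lengths up to 8 only 5 and 7 do not divide 24. *)
Definition order_multiple p s := (code_pow s 24 != pts) && (code_pow s (24 * p) == pts).

Lemma order_multipleP p x : prime p -> order_multiple p (code x) -> p %| #[x].
Proof.
move=> p_pr /andP[]; rewrite -!codeX -code1 (inj_eq code_inj) => x24 /eqP/code_inj.
exact: prime_dvd_order.
Qed.

(** The second generator may be replaced by its [k]-th power, which generates a subgroup with the
    first that is already everything. *)
Lemma gen_of_profile m1 m2 k t p g :
    m1 \in shapes -> m2 \in shapes -> code_pow (std_code m2) k == t ->
    generates_profile (std_code m1) t -> prime p -> 8 < p.*2 ->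
    order_multiple p (std_code m1) || order_multiple p t ->
  <<[set shape_perm m1; shape_perm m2 ^ g]>> = [set: 'S_8].
Proof.
move=> m1S m2S /eqP<-; rewrite -!code_shape_perm // -codeX => gen p_pr lt8p p_xy.
apply/eqP; rewrite eqEsubset subsetT -(generates_profileP g gen p_pr _ lt8p) /=.
  rewrite gen_subG conjXg; apply/subsetP=> x.
  by case/set2P=> ->; rewrite ?groupX // mem_gen // !inE eqxx ?orbT.
by case/orP: p_xy => /(order_multipleP p_pr); [left | right].
Qed.

(** * Adjacency of classes in Lambda(S_8) *)

(** Profiles are invariant under conjugation and, by a check of all pairs, separate the shapes. *)
Lemma shape_class_inj : {in shapes &, injective shape_class}.
Proof.
move=> m1 m2 m1S m2S eq_class.
have: shape_perm m2 \in shape_class m1 by rewrite eq_class class_refl.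
case/imsetP=> g _ def_m2; have := same_profileJ (shape_perm m1) g.
rewrite -def_m2 !code_shape_perm //.
have: all (fun m1 => all (fun m2 =>
    same_profile (std_code m1) (std_code m2) ==> (m1 == m2)) shapes) shapes.
  by vm_compute.
by move/allP/(_ _ m1S)/allP/(_ _ m2S)/implyP=> + /[dup] => /[apply] /eqP.
Qed.

Local Notation G := [set: 'S_8]%G.

Lemma shape_perm_eq1 m : m \in shapes -> (shape_perm m == 1) = (m == one_shape).
Proof.
move=> mS; rewrite -(inj_eq code_inj) code1 code_shape_perm //.
have: all (fun m => (std_code m == pts) == (m == one_shape)) shapes by vm_compute.
by move/allP/(_ _ mS)/eqP.
Qed.

Lemma Lambda_adj_shape_class m1 m2 : m1 \in shapes -> m2 \in shapes ->
  reflect [/\ m1 != one_shape, m2 != one_shape, m1 != m2 &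
             forall a b, <<[set shape_perm m1 ^ a; shape_perm m2 ^ b]>> = [set: 'S_8]]
          (adj (Lambda G) (shape_class m1) (shape_class m2)).
Proof.
move=> m1S m2S; rewrite -!shape_perm_eq1 //.
have nt m : m \in shapes -> shape_class m \in Lambda_vertices G -> shape_perm m != 1.
  move=> mS; rewrite !inE => /andP[ncls _]; apply: contraNneq ncls => pm1.
  by rewrite /shape_class pm1 class1G.
have [-> | neq_m] := eqVneq m1 m2; first by rewrite adj_irr; constructor=> [[]].
have neq_class: shape_class m1 != shape_class m2 by rewrite (inj_in_eq shape_class_inj).
have neq_perm: shape_perm m1 != shape_perm m2.
  by apply: contraNneq neq_class => eq_perm12; rewrite /shape_class eq_perm12.
apply: (iffP idP) => [adj12 | [nt1 nt2 _ gen]].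
  have /andP[/(nt _ m1S) nt1 /(nt _ m2S) nt2] := adj_vertices adj12.
  split=> // a b; move: adj12; rewrite Lambda_adj_class ?inE // => /inv_gen2P.
  by apply; rewrite ?inE.
by rewrite Lambda_adj_class ?inE //; apply/inv_gen2P; rewrite ?inE.
Qed.

(** Simultaneous conjugation by [a] reduces to a fixed first generator. *)
Lemma gen_conj x y :
    (forall g, <<[set x; y ^ g]>> = [set: 'S_8]) ->
  forall a b, <<[set x ^ a; y ^ b]>> = [set: 'S_8].
Proof.
move=> gen a b; have ->: [set x ^ a; y ^ b] = [set x; y ^ (b * a^-1)] :^ a.
  by rewrite conjUg !conjg_set1 -conjgM mulgKV.
by rewrite genJ gen; apply/setP=> z; rewrite mem_conjg !inE.
Qed.

Lemma adj_edges : {in edges, forall e, adj (Lambda G) (shape_class e.1) (shape_class e.2)}.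
Proof.
have adj_gen k t p m1 m2 : generates_profile (std_code m1) t ->
    [&& m1 \in shapes, m2 \in shapes, m1 != one_shape, m2 != one_shape, m1 != m2 &
      [&& code_pow (std_code m2) k == t, prime p, 8 < p.*2 &
          order_multiple p (std_code m1) || order_multiple p t]] ->
    adj (Lambda G) (shape_class m1) (shape_class m2).
  move=> gen /and5P[m1S m2S nt1 nt2 /and5P[neq def_t p_pr lt8p p_xy]].
  apply/Lambda_adj_shape_class=> //; split=> //; apply: gen_conj => g.
  exact: gen_of_profile def_t gen p_pr lt8p p_xy.
move=> e; rewrite !inE.
(* The 6th powers of the shapes (5, 3) and (5, 2, 1) are 5-cycles. *)
case/or4P=> [/eqP->|/eqP->|/eqP->|/or4P[/eqP->|/eqP->|/eqP->|/orP[]/eqP->]] /=.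
- by apply: (adj_gen 6 _ 5 _ _ generates_8_5); vm_compute.
- by apply: (adj_gen 6 _ 5 _ _ generates_8_5); vm_compute.
- by apply: (adj_gen 6 _ 5 _ _ generates_8_5); vm_compute.
- by apply: (adj_gen 1%N _ 7 _ _ generates_7_422); vm_compute.
- by apply: (adj_gen 1%N _ 7 _ _ generates_7_332); vm_compute.
- by apply: (adj_gen 1%N _ 5 _ _ generates_6_53); vm_compute.
- by apply: (adj_gen 1%N _ 5 _ _ generates_53_422); vm_compute.
- by apply: (adj_gen 1%N _ 5 _ _ generates_521_44); vm_compute.
Qed.

Lemma Lambda_edge :
  {in shapes &, forall m1 m2,
    adj (Lambda G) (shape_class m1) (shape_class m2) = edge m1 m2}.
Proof.
move=> m1 m2 m1S m2S; apply/idP/idP=> [/(Lambda_adj_shape_class m1S m2S)[nt1 nt2 neq gen] | ].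
  exact: edge_of_gen.
by case/orP=> /adj_edges //; rewrite adj_sym.
Qed.

(** * Distances in Xi(S_8) *)

(** The ends of an edge are not isolated, so passing to [Xi] loses no edge. *)
Lemma Xi_adjE (gT : finGroupType) (K : {group gT}) : adj (Xi K) =2 adj (Lambda K).
Proof.
move=> C D; rewrite /= /induced_adj /= andbA andb_idl // => CD.
have /andP[VC VD] := Lambda_adj_vertices CD.
rewrite !inE /isolated /= !negb_and; apply/andP; split; apply/orP; right.
  by apply/forall_inPn; exists D; rewrite ?negbK.
by apply/forall_inPn; exists C; rewrite ?negbK // Lambda_adj_sym.
Qed.

(* The tree Xi(S_8), rooted at the class of shape (5, 3). *)
Definition routes : seq (seq nat * seq (seq nat)) :=
  [:: ([:: 4; 4], [:: [:: 5; 2; 1]; [:: 8]; [:: 5; 3]]);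
      ([:: 5; 2; 1], [:: [:: 8]; [:: 5; 3]]);
      ([:: 8], [:: [:: 5; 3]]);
      ([:: 5; 3], [::]);
      ([:: 5; 1; 1; 1], [:: [:: 8]; [:: 5; 3]]);
      ([:: 6; 1; 1], [:: [:: 5; 3]]);
      ([:: 4; 2; 2], [:: [:: 5; 3]]);
      ([:: 7; 1], [:: [:: 4; 2; 2]; [:: 5; 3]]);
      ([:: 3; 3; 2], [:: [:: 7; 1]; [:: 4; 2; 2]; [:: 5; 3]])]%N.

Definition Xi_shapes := map fst routes.

(** Distances from (4, 4) in the tree, in the order of [Xi_shapes]. *)
Definition depth44 m := nth 0 [:: 0; 1; 2; 3; 3; 4; 4; 5; 6]%N (index m Xi_shapes).

Lemma Xi_shapes_sub : {subset Xi_shapes <= shapes}.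
Proof. by apply/allP; vm_compute. Qed.

Lemma edge_Xi_shapes m1 m2 : edge m1 m2 -> m1 \in Xi_shapes.
Proof.
have /allP sub: all (fun e => (e.1 \in Xi_shapes) && (e.2 \in Xi_shapes)) edges by vm_compute.
by case/orP=> /sub/andP[].
Qed.

Lemma Lambda_vertex_shape C :
  C \in vertices (Lambda G) -> exists2 m, m \in shapes & C = shape_class m.
Proof.
rewrite !inE => /andP[_ /imsetP[x _ ->]]; have [m mS x_m] := class_shape x.
by exists m => //; apply: class_eqP.
Qed.

Lemma Xi_vertex_shape C :
  C \in vertices (Xi G) -> exists2 m, m \in Xi_shapes & C = shape_class m.
Proof.
rewrite inE => /andP[VC]; rewrite inE /isolated VC andTb.
case/forall_inPn=> D /Lambda_vertex_shape[m2 m2S ->]; rewrite negbK.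
have [m1 m1S ->] := Lambda_vertex_shape VC.
by rewrite Lambda_edge // => /edge_Xi_shapes; exists m1.
Qed.

Lemma shape_class_Xi_vertex m : m \in Xi_shapes -> shape_class m \in vertices (Xi G).
Proof.
have: all (fun m => has (edge m) Xi_shapes) Xi_shapes by vm_compute.
move=> /allP nbr mX; have /hasP[n nX mn] := nbr m mX.
have: adj (Xi G) (shape_class m) (shape_class n) by rewrite Xi_adjE Lambda_edge // Xi_shapes_sub.
by case/adj_vertices/andP.
Qed.

(** Up from [m] to the root, then down to [n]. The reversed list starts with the root, where the
    first half has ended, hence [behead]. *)
Definition walk m n :=
  let route k := nth [::] (map snd routes) (index k Xi_shapes) in
  route m ++ behead (rev (n :: route n)).

Lemma walkP m n : m \in Xi_shapes -> n \in Xi_shapes ->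
  [/\ path edge m (walk m n), last m (walk m n) = n & size (walk m n) <= 6].
Proof.
move=> mX nX.
have: all (fun m => all (fun n => [&& path edge m (walk m n), last m (walk m n) == n
   & size (walk m n) <= 6]) Xi_shapes) Xi_shapes by vm_compute.
by move/allP/(_ _ mX)/allP/(_ _ nX)/and3P=> [? /eqP].
Qed.

Lemma path_cons (T : Type) (e : rel T) x y p : path e x (y :: p) = e x y && path e y p.
Proof. by []. Qed.

Lemma Xi_walk m n : m \in Xi_shapes -> n \in Xi_shapes ->
  exists2 p, path (adj (Xi G)) (shape_class m) p
           & last (shape_class m) p = shape_class n /\ size p <= 6.
Proof.
move=> mX nX; have [mn last_mn le6] := walkP mX nX.
exists (map shape_class (walk m n)); last by rewrite size_map last_map last_mn.
move: (walk m n) mn {last_mn le6} => w.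
elim: w m mX => // k w IHw m mX; rewrite map_cons !path_cons => /andP[mk kw].
have kX: k \in Xi_shapes by apply: (@edge_Xi_shapes k m); rewrite /edge orbC.
by rewrite IHw // Xi_adjE Lambda_edge ?mk // Xi_shapes_sub.
Qed.

(** [depth44] grows by at most 1 along an edge, so it bounds the length of a walk from below. *)
Lemma depth_path m p : m \in Xi_shapes -> path (adj (Xi G)) (shape_class m) p ->
  exists n, [/\ n \in Xi_shapes, last (shape_class m) p = shape_class n
              & depth44 n <= depth44 m + size p].
Proof.
elim: p m => [|C p IHp] m mX; first by exists m; rewrite addn0.
rewrite path_cons last_cons => /andP[mC Cp].
have /andP[_ /Xi_vertex_shape[k kX def_C]] := adj_vertices mC.
rewrite {C}def_C in mC Cp *; have [n [nX def_n le_n]] := IHp k kX Cp.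
exists n; split=> //; apply: leq_trans le_n _; rewrite addnS -addSn leq_add2r.
move: mC; rewrite Xi_adjE Lambda_edge ?Xi_shapes_sub //.
have: all (fun m => all (fun k =>
    edge m k ==> (depth44 k <= (depth44 m).+1)) Xi_shapes) Xi_shapes by vm_compute.
by move/allP/(_ _ mX)/allP/(_ _ kX)/implyP.
Qed.

Theorem lemma3p7 :
  connected (Xi [set: 'S_8]%G) /\ diameter (Xi [set: 'S_8]%G) = 6.
Proof.
split.
  apply/forall_inP=> _ /Xi_vertex_shape[m mX ->].
  apply/forall_inP=> _ /Xi_vertex_shape[n nX ->].
  by have [p mp [<- _]] := Xi_walk mX nX; apply/connectP; exists p.
apply/eqP; rewrite eqn_leq; apply/andP; split.
  apply/bigmax_leqP=> _ /Xi_vertex_shape[m mX ->].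
  apply/bigmax_leqP=> _ /Xi_vertex_shape[n nX ->].
  by have [p mp [<- le6]] := Xi_walk mX nX; apply: leq_trans (dist_le mp) le6.
(* The extremal pair: [depth44] is 0 at [m] and 6 at [n]. *)
pose m : seq nat := [:: 4; 4]; pose n : seq nat := [:: 3; 3; 2].
have mX: m \in Xi_shapes by []; have nX: n \in Xi_shapes by [].
have le_mn: 6 <= dist (Xi G) (shape_class m) (shape_class n).
  have [p mp [def_n _]] := Xi_walk mX nX.
  have /dist_connect[q [mq last_q <-]]: connect (adj (Xi G)) (shape_class m) (shape_class n).
    by apply/connectP; exists p.
  have [k [kX]] := depth_path mX mq; rewrite last_q => /shape_class_inj.
  by move=> <-; rewrite ?Xi_shapes_sub.
apply: (leq_trans le_mn).
apply: (bigmax_sup (shape_class m)); first exact: shape_class_Xi_vertex.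
by apply: (bigmax_sup (shape_class n)); first exact: shape_class_Xi_vertex.
Qed.
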